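(* Fix integers $L\ge 2$, $D\ge 1$, class centroids $\boldsymbol\mu_1,\dots,\boldsymbol\mu_L\in\mathbb R^D$, and a diagonal covariance matrix $\mathbf C=\mathrm{diag}(C_{1,1},\dots,C_{D,D})$ with $C_{d,d}>0$. Let $\tilde{\mathcal D}\subseteq\{1,\dots,D\}$ be a nonempty set of selected feature dimensions such that the reduced centroids $\tilde{\boldsymbol\mu}_\ell$ (restrictions of $\boldsymbol\mu_\ell$ to the coordinates in $\tilde{\mathcal D}$) are pairwise distinct, and let $\tilde{\mathbf C}$ be the restriction of $\mathbf C$ to $\tilde{\mathcal D}\times\tilde{\mathcal D}$. Let $\mathcal S$ be a nonempty finite set of sensors with fixed weights $w_m\ge 0$, $\sum_{m\in\mathcal S}w_m=1$. Fix a ground-truth class $\ell_0$, relevance indicators $I_m\in\{0,1\}$ for $m\in\mathcal S$, and, for each $m$ with $I_m=0$, a class $\ell_m\neq\ell_0$. Suppose the reduced features $\tilde{\mathbf f}_m$, $m\in\mathcal S$, are independent with $\tilde{\mathbf f}_m\sim\mathcal N(\tilde{\boldsymbol\mu}_{\ell_0},\tilde{\mathbf C})$ if $I_m=1$ and $\tilde{\mathbf f}_m\sim\mathcal N(\tilde{\boldsymbol\mu}_{\ell_m},\tilde{\mathbf C})$ if $I_m=0$. Let $\tilde{\mathbf f}_{\mathsf g}=\sum_{m\in\mathcal S}w_m\tilde{\mathbf f}_m$ and let $\hat\ell\in\arg\min_{\ell} (\tilde{\mathbf f}_{\mathsf g}-\tilde{\boldsymbol\mu}_\ell)^T\tilde{\mathbf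 C}^{-1}(\tilde{\mathbf f}_{\mathsf g}-\tilde{\boldsymbol\mu}_\ell)$. Then $$\Pr(\hat\ell=\ell_0)\ \ge\ 1-(L-1)\,Q\!\left[\frac{1}{\sqrt{\eta}}\left(\frac{\sqrt{\tilde G_{\min}}}{2}-2(1-\rho)\tilde\delta_{\max}\right)\right],$$ where $\rho=\sum_{m\in\mathcal S}I_m w_m$, $\eta=\sum_{m\in\mathcal S}w_m^2$, $\tilde G_{\min}=\min_{\ell\neq\ell'}\sum_{d\in\tilde{\mathcal D}}\frac{(\mu_{\ell,d}-\mu_{\ell',d})^2}{C_{d,d}}$ and $\tilde\delta_{\max}=\max_\ell\sqrt{\sum_{d\in\tilde{\mathcal D}}\frac{\mu_{\ell,d}^2}{C_{d,d}}}$. Consequently the same lower bound holds for the accuracy averaged over a uniformly distributed $\ell_0\in\{1,\dots,L\}$ and over any distribution of the irrelevant sensors' classes $\ell_m\ne\ell_0$. *)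

(* Defs.v *)
From HB Require Import structures.
From mathcomp Require Import all_boot all_order all_algebra.
From mathcomp Require Import all_classical all_reals all_analysis.
Set Implicit Arguments. Unset Strict Implicit. Unset Printing Implicit Defensive.
Import Order.TTheory GRing.Theory Num.Theory.
Local Open Scope classical_set_scope.
Local Open Scope ring_scope.

Definition indep_family d (T : measurableType d) (R : realType)
  (P : probability T R) (I : finType) (J : {set I}) (X : I -> T -> R) : Prop :=
  forall (K : {set I}) (B : I -> set R),
    K \subset J -> (forall i, measurable (B i)) ->
    P (\bigcap_(i in [set i | i \in K]) (X i @^-1` B i)) =
    (\prod_(i in K) P (X i @^-1` B i))%E.

(* The reduced features f m (restricted to the coordinates in Dsel) are
   independent across sensors m, and f m ~ N(mu_(cls m) restricted to Dsel,
   C restricted to Dsel x Dsel), C = diag(C 0, ..., C (D-1)).  Since the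
   covariance is diagonal, the Gaussian density of f m factorizes, i.e. the
   coordinates (f m dd)_{dd in Dsel} are independent N(mu_(cls m),dd , C dd);
   normal_prob takes the standard deviation, hence Num.sqrt (C dd). *)
Definition gauss_sensor_model d (T : measurableType d) (R : realType)
  (P : probability T R) (L D : nat) (S : finType)
  (mu : 'I_L -> 'I_D -> R) (C : 'I_D -> R) (Dsel : {set 'I_D})
  (cls : S -> 'I_L) (f : S -> 'I_D -> T -> R) : Prop :=
  [/\ forall m dd, dd \in Dsel -> measurable_fun setT (f m dd),
      indep_family P [set p : S * 'I_D | p.2 \in Dsel] (fun p => f p.1 p.2) &
      forall m dd, dd \in Dsel -> forall B : set R, measurable B ->
        P (f m dd @^-1` B) = normal_prob (mu (cls m) dd) (Num.sqrt (C dd)) B].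

(* (f_g - mu_l)^T Ctilde^{-1} (f_g - mu_l) with f_g = sum_m w_m f_m,
   written out for the diagonal matrix Ctilde. *)
Definition maha (R : realType) (T : Type) (L D : nat) (S : finType)
  (w : S -> R) (mu : 'I_L -> 'I_D -> R) (C : 'I_D -> R) (Dsel : {set 'I_D})
  (f : S -> 'I_D -> T -> R) (om : T) (l : 'I_L) : R :=
  \sum_(dd in Dsel) (\sum_(m : S) w m * f m dd om - mu l dd) ^+ 2 / C dd.

Definition is_mindist_classifier (R : realType) (T : Type) (L D : nat)
  (S : finType) (w : S -> R) (mu : 'I_L -> 'I_D -> R) (C : 'I_D -> R)
  (Dsel : {set 'I_D}) (f : S -> 'I_D -> T -> R) (lhat : T -> 'I_L) : Prop :=
  forall om l, maha w mu C Dsel f om (lhat om) <= maha w mu C Dsel f om l.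

Definition Qfun (R : realType) (x : R) : \bar R :=
  normal_prob 0 1 `]x, +oo[%classic.

Definition Gpair (R : realType) (L D : nat) (mu : 'I_L -> 'I_D -> R)
  (C : 'I_D -> R) (Dsel : {set 'I_D}) (l l' : 'I_L) : R :=
  \sum_(dd in Dsel) (mu l dd - mu l' dd) ^+ 2 / C dd.

Definition Gmin (R : realType) (L D : nat) (mu : 'I_L -> 'I_D -> R)
  (C : 'I_D -> R) (Dsel : {set 'I_D}) : R :=
  inf [set x | exists l l' : 'I_L, l != l' /\ x = Gpair mu C Dsel l l'].

Definition delta_max (R : realType) (L D : nat) (mu : 'I_L -> 'I_D -> R)
  (C : 'I_D -> R) (Dsel : {set 'I_D}) : R :=
  sup (range (fun l : 'I_L => Num.sqrt (\sum_(dd in Dsel) mu l dd ^+ 2 / C dd))).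

Definition acc_bound (R : realType) (L D : nat) (S : finType)
  (w : S -> R) (I : S -> bool) (mu : 'I_L -> 'I_D -> R) (C : 'I_D -> R)
  (Dsel : {set 'I_D}) : \bar R :=
  let rho := \sum_(m : S) (I m)%:R * w m in
  let eta := \sum_(m : S) w m ^+ 2 in
  (1 - (L.-1)%:R%:E * Qfun ((Num.sqrt eta)^-1 *
       (Num.sqrt (Gmin mu C Dsel) / 2 - 2 * (1 - rho) * delta_max mu C Dsel)))%E.

(* Main.v *)
(* If class l is chosen instead of l0, the statistic
   Y = sum_(m, d) w_m (mu_(l, d) - mu_(l0, d)) / C_d * f_(m, d)
   lies above the midpoint threshold t = sum_d (mu_(l, d)^2 - mu_(l0, d)^2) / (2 C_d).
   Y is Gaussian with variance eta G, where G = Gpair l l0, and Cauchy-Schwarz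
   shows that irrelevant sensors move its mean by at most
   2 (1 - rho) delta_max sqrt G towards t; dividing by sqrt (eta G) bounds each
   pairwise error by Q, and a union bound over the L - 1 wrong classes concludes.
   That Y is Gaussian follows from the rotation invariance of N(0, 1) x N(0, 1),
   adding one independent variable at a time. *)
Require Import Defs.
From HB Require Import structures.
From mathcomp Require Import all_boot all_order all_algebra.
From mathcomp Require Import all_classical all_reals all_analysis.
From mathcomp Require Import measurable_realfun ring lra.
Import Order.TTheory GRing.Theory Num.Theory.
Local Open Scope classical_set_scope.
Local Open Scope ring_scope.

(** Measurable rectangles are stable under intersection, generate the product sigma-algebra and
    include the whole space. As [m1] is finite there, the constant sequence [setT] serves as
    exhausting sequence. *)
Lemma measure_prod_unique {d1 d2} {T1 : measurableType d1} {T2 : measurableType d2}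
    {R : realType} {m1 m2 : {measure set (T1 * T2) -> \bar R}} :
  (m1 setT < +oo)%E ->
  (forall A B, measurable A -> measurable B -> m1 (A `*` B) = m2 (A `*` B)) ->
  forall X, measurable X -> m1 X = m2 X.
Proof.
move=> m1T m12 X mX.
pose C : set (set (T1 * T2)) := [set A `*` B | A in measurable & B in measurable].
apply: (measure_unique C (fun _ => setT)) => //.
- by rewrite measurable_prod_measurableType.
- move=> _ _ [A1 mA1 [A2 mA2 <-]] [B1 mB1 [B2 mB2 <-]].
  rewrite -setXI; exists (A1 `&` B1); first exact: measurableI.
  by exists (A2 `&` B2) => //; exact: measurableI.
- by move=> _; exists setT => //; exists setT => //; rewrite setXTT.
- by rewrite bigcup_const//; exists 0%N.
- by move=> _ [A mA [B mB <-]]; exact: m12.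
Qed.

(** * Affine images of Lebesgue measure and of normal laws *)

Section gaussian.
Context {R : realType}.
Notation leb := (@lebesgue_measure R).
Notation N01 := (@normal_prob R 0 1).

Lemma measurable_affine (a b : R) : measurable_fun setT (fun x : R => a * x + b).
Proof. by apply: measurable_funD => //; apply: measurable_funM. Qed.

(** For [a > 0] the preimage of a half-open interval is again of the form []c, d]], so the rescaled
    image measure agrees with Lebesgue measure on the intervals that determine it. A negative slope
    would swap the open and closed ends; it is reduced to the positive case by reflection
    invariance. *)
Lemma lebesgue_measure_affine (a b : R) (A : set (measurableTypeR R)) :
  a != 0 -> measurable A ->
  (`|a|%:E * leb ((fun x : measurableTypeR R => (a * x + b)%R : measurableTypeR R) @^-1` A)
   = leb A)%E.
Proof.
move=> + mA; wlog a0 : a A mA / 0 < a => [wlg|_].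
  have [a0|a0|->] := ltgtP a 0; last by [].
  - have -> : (fun x : measurableTypeR R => a * x + b) =
      (fun x : measurableTypeR R => - a * x + b) \o -%R.
      by apply/funext => x /=; rewrite mulrNN.
    rewrite comp_preimage => _.
    rewrite -[X in (_ * X)%E]/(pushforward leb (-%R : _ -> measurableTypeR R) _).
    rewrite lebesgue_measureN; last first.
      rewrite -[X in measurable X]setTI; exact: measurable_affine.
    by rewrite -normrN wlg// ?oppr_eq0 ?oppr_gt0// lt_eqF.
  - by move=> _; apply: wlg => //; rewrite gt_eqF.
pose phi (x : measurableTypeR R) : measurableTypeR R := a * x + b.
have mphi : measurable_fun setT phi by exact: measurable_affine.
have a0' := ltW a0.
pose nu : {measure set (measurableTypeR R) -> \bar R} :=
  mscale (NngNum a0') (pushforward leb phi).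
rewrite gtr0_norm//; apply/esym; rewrite -[RHS]/(nu mphi A).
apply: (lebesgue_measure_unique (mu := nu mphi)) => //= _ [[c d]] _ <-.
rewrite /nu /= /mscale /= /pushforward /=.
have -> : phi @^-1` [set` `]c, d]] = [set` `](c - b) / a, (d - b) / a]].
  apply/seteqP; split => x /=; rewrite !in_itv/= /phi ltr_pdivrMr// ler_pdivlMr//;
  by rewrite ltrBlDr lerBrDr (mulrC a).
rewrite !lebesgue_measure_itv/= !lte_fin ltr_pM2r ?invr_gt0// ltrD2r.
case: ifP => _; last by rewrite mule0.
rewrite -!EFinB -EFinM; congr EFin.
by field; rewrite gt_eqF.
Qed.

Lemma ge0_integral_affine (a b : R) (f : R -> \bar R) :
  a != 0 -> measurable_fun setT f -> (forall x, 0 <= f x)%E ->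
  (\int[leb]_x f x = \int[leb]_x (`|a|%:E * f (a * x + b)%R))%E.
Proof.
move=> a0 mf f0.
pose phi (x : measurableTypeR R) : measurableTypeR R := a * x + b.
have mphi : measurable_fun setT phi by exact: measurable_affine.
pose nu : {measure set (measurableTypeR R) -> \bar R} :=
  mscale (NngNum (normr_ge0 a)) (pushforward leb phi).
transitivity (\int[nu mphi]_x f x)%E.
  apply: eq_measure_integral => A mA _.
  exact/esym/(lebesgue_measure_affine a b A a0 mA).
rewrite ge0_integral_mscale//= ge0_integral_pushforward//= ge0_integralZl//=.
exact: (@measurableT_comp _ _ _ _ _ _ f).
Qed.

(** The Jacobian [|s|] cancels the factor 1/|s| in the peak of the density. Negative [s] is allowed
    so that [s = -1] gives the symmetry of N(0, 1). *)
Lemma normal_prob_affine (m s : R) (A : set (measurableTypeR R)) :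
  s != 0 -> measurable A ->
  normal_prob m `|s| A = normal_prob 0 1 ((fun z : R => s * z + m) @^-1` A).
Proof.
move=> s0 mA; rewrite /normal_prob.
have mB : measurable ((fun z : R => s * z + m) @^-1` A).
  rewrite -[X in measurable X]setTI; exact: measurable_affine.
rewrite integral_mkcond [RHS]integral_mkcond (ge0_integral_affine s m)//; last 2 first.
- apply/(measurable_restrictT _ _).1 => //; apply/measurable_EFinP/measurable_funTS.
  exact: measurable_normal_pdf.
- by move=> x; rewrite patchE; case: ifP => // _; rewrite lee_fin normal_pdf_ge0.
apply: eq_integral => x _; rewrite !patchE -[x \in _]/(s * x + m \in A).
case: ifP => _; last by rewrite mule0.
rewrite -EFinM; congr EFin; rewrite !normal_pdfE ?normr_eq0 ?oner_eq0//.
rewrite /normal_peak /normal_fun addrK subr0.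
rewrite real_normK ?num_real// expr1n !mul1r -mulrnAr sqrtrM ?sqr_ge0// sqrtr_sqr.
rewrite invfM !mulrA divff ?normr_eq0// mul1r; congr (_ * expR _).
by field.
Qed.

(** * Densities and rotation invariance of N(0, 1) x N(0, 1) *)

(** The Radon-Nikodym derivative is determined only almost everywhere; it agrees with [normal_pdf]
    because both have the same integral over every measurable set. *)
Lemma integral_normal_prob (m s : R) (f : R -> \bar R) :
  s != 0 -> (normal_prob m s).-integrable setT f ->
  (\int[normal_prob m s]_x f x = \int[leb]_x (f x * (normal_pdf m s x)%:E))%E.
Proof.
move=> s0 fi.
rewrite -(Radon_Nikodym_change_of_variables (normal_prob_dominates m s))//=.
have mf := measurable_int _ fi.
apply: ae_eq_integral => //.
- apply: emeasurable_funM => //; apply: (measurable_int leb).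
  by apply: Radon_Nikodym_integrable; exact: normal_prob_dominates.
- apply: emeasurable_funM => //=; apply/measurableT_comp => //=.
  exact: measurable_normal_pdf.
- apply: ae_eqe_mul2l => /=.
  rewrite Radon_NikodymE//=; first exact: normal_prob_dominates.
  move=> abmu; case: cid => /= h [h1 h2 h3].
  apply: integral_ae_eq => //=.
  + by apply/measurableT_comp =>//; exact: measurable_normal_pdf.
  + by move=> E E01 mE; rewrite -h3.
Qed.

Lemma normal_probE (m s : R) (A : set R) : measurable A ->
  normal_prob m s A = (\int[leb]_x (\1_A x * normal_pdf m s x)%:E)%E.
Proof.
move=> mA; rewrite /normal_prob integral_mkcond; apply: eq_integral => x _.
by rewrite patchE indicE; case: ifP => _; rewrite ?mul1r ?mul0r.
Qed.

(* Invariance of the density of N(0, 1) x N(0, 1) under the reflection taking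
   (x, y) to (z, y') with r z = s1 x + s2 y. *)
Lemma normal_pdf_rotation (s1 s2 r x z : R) :
  s2 != 0 -> r ^+ 2 = s1 ^+ 2 + s2 ^+ 2 ->
  normal_pdf 0 1 x * normal_pdf 0 1 ((r * z - s1 * x) / s2) =
  normal_pdf 0 1 z * normal_pdf 0 1 ((r * x - s1 * z) / s2).
Proof.
move=> s20 rE; rewrite !normal_pdfE ?oner_eq0// /normal_fun !subr0.
rewrite [RHS]mulrACA [LHS]mulrACA -!expRD; congr (_ * expR _).
rewrite expr1n -!mulrDl -!opprD !exprMn !exprVn.
congr (- _ * _).
have s2E : s2 ^+ 2 = r ^+ 2 - s1 ^+ 2 by rewrite rE; ring.
have s22 : r ^+ 2 - s1 ^+ 2 != 0 by rewrite -s2E expf_neq0.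
by rewrite s2E; field.
Qed.

Lemma normal_prob_oppr (A : set R) : measurable A ->
  N01 ([set z | A (- z)]) = N01 A.
Proof.
move=> mA; have := normal_prob_affine 0 (-1) A _ mA.
rewrite normrN1 => ->; last by rewrite oppr_eq0 oner_eq0.
by congr normal_prob; apply/seteqP; split => x /=; rewrite mulN1r addr0.
Qed.

(** On the fibre over x, replacing y by z with r z = s1 x + s2 y gives (x, z) the joint density
    [normal_pdf 0 1 x * K z x]. By [normal_pdf_rotation] this equals [normal_pdf 0 1 z * K x z];
    after Tonelli, integrating out x leaves the density of z. *)
Lemma normal_prob_rotation (s1 s2 : R) (A : set R) : measurable A ->
  (N01 \x N01)%E [set p : R * R | A (s1 * p.1 + s2 * p.2)] =
  N01 [set z | A (Num.sqrt (s1 ^+ 2 + s2 ^+ 2) * z)].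
Proof.
move=> mA.
have mscal (s : R) : measurable [set z | A (s * z)].
  rewrite -[X in measurable X]setTI.
  exact: (@measurable_funM _ _ _ _ (cst s) id).
(* The substitution divides by [s2], so this case is separate: the set is a rectangle, and since the
   square root yields [|s1|], a negative [s1] is handled by symmetry. *)
have [->|s20] := eqVneq s2 0.
  have -> : [set p : R * R | A (s1 * p.1 + 0 * p.2)] = [set z | A (s1 * z)] `*` setT.
    by apply/seteqP; split => -[x y] /=; rewrite mul0r addr0//; case.
  have N1 : N01 setT = 1%E by exact: probability_setT.
  rewrite product_measure1E//; last exact: mscal.
  rewrite -[LHS]/(N01 _ * N01 setT)%E N1 mule1.
  rewrite expr0n addr0 sqrtr_sqr.
  have [s1p|s1n] := leP 0 s1; first by rewrite ger0_norm.
  rewrite -normal_prob_oppr; last exact: mscal.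
  by congr normal_prob; apply/seteqP; split => x /=; rewrite ltr0_norm// mulrN ?mulNr.
set r := Num.sqrt _.
have r2 : r ^+ 2 = s1 ^+ 2 + s2 ^+ 2 by rewrite sqr_sqrtr// addr_ge0 ?sqr_ge0.
have r0 : r != 0 by rewrite sqrtr_eq0 -ltNge ltr_wpDl ?sqr_ge0// exprn_even_gt0.
have rs0 : r / s2 != 0 by rewrite mulf_neq0// invr_eq0.
set X := [set p | _].
(* In its first argument, [K x z] is the normal density with mean s1 z / r and standard deviation
   |s2 / r|, hence the total mass 1 proved in [K1]. *)
pose K x z : R := `|r / s2| * normal_pdf 0 1 ((r * x - s1 * z) / s2).
have mK : measurable_fun setT (fun p : R * R => K p.2 p.1).
  apply: measurable_funM => //; apply: measurableT_comp; first exact: measurable_normal_pdf.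
  apply: measurable_funM => //; apply: measurable_funB; apply: measurable_funM => //.
have K0 x z : 0 <= K x z by rewrite mulr_ge0 ?normal_pdf_ge0.
have mKl x : measurable_fun setT (fun z => K z x).
  exact: (measurable_fun_pair2 x mK).
have mA1 : measurable_fun setT (fun z => \1_A (r * z) : R).
  apply: (@measurableT_comp _ _ _ _ _ _ (\1_A : R -> R)); first exact: measurable_indic.
  exact: measurable_funM.
have K1 z : (\int[leb]_x (K x z)%:E = 1)%E.
  rewrite -(integral_normal_pdf 0 1).
  rewrite [RHS](ge0_integral_affine (r / s2) (- (s1 * z) / s2) _ rs0); last 2 first.
  - by apply/measurable_EFinP; exact: measurable_normal_pdf.
  - by move=> x; rewrite lee_fin normal_pdf_ge0.
  apply: eq_integral => x _; rewrite -EFinM /K; congr (_ * normal_pdf _ _ _)%:E.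
  by field.
have mX : measurable X.
  rewrite -[Y in measurable Y]setTI.
  apply: (@measurable_funD _ _ _ _ (fun p : R * R => s1 * p.1) (fun p : R * R => s2 * p.2)) => //;
  exact: measurable_funM.
have secE x : N01 (xsection X x) =
   (\int[leb]_z (\1_A (r * z) * K z x)%:E)%E.
  rewrite normal_probE; last exact: measurable_xsection.
  rewrite [LHS](ge0_integral_affine (r / s2) (- (s1 * x) / s2) _ rs0); last 2 first.
  - apply/measurable_EFinP; apply: measurable_funM; last exact: measurable_normal_pdf.
    by apply: measurable_indic; exact: measurable_xsection.
  - by move=> z; rewrite lee_fin mulr_ge0// normal_pdf_ge0.
  apply: eq_integral => z _; rewrite -EFinM /K; congr EFin.
  rewrite mulrCA; congr (_ * (_ * normal_pdf _ _ _)); last by field.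
  rewrite !indicE mem_xsection; set y := r / s2 * z + _.
  rewrite -[_ \in X]/((s1 * x + s2 * y) \in A).
  by congr (nat_of_bool (_ \in A))%:R; rewrite /y; field.
(* Domination by the constant 1 supplies the integrability that [integral_normal_prob] asks for. *)
have xsec1 x : (N01 (xsection X x) <= 1)%E.
  by apply: probability_le1; exact: measurable_xsection.
transitivity (\int[leb]_x \int[leb]_z (\1_A (r * z) * K z x * normal_pdf 0 1 x)%:E)%E.
  rewrite /product_measure1 integral_normal_prob ?oner_eq0//; last first.
    apply: (@le_integrable _ _ _ _ _ _ _ (cst 1%E)) => //.
    - exact: measurable_fun_xsection.
    - by move=> x _; rewrite gee0_abs//= normr1; exact: xsec1.
    - exact: finite_measure_integrable_cst.
  apply: eq_integral => x _.
  have /= -> := secE x; rewrite muleC -ge0_integralZl//.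
  - by apply: eq_integral => z _; rewrite -EFinM mulrC.
  - apply/measurable_EFinP; apply: measurable_funM; [exact: mA1 | exact: mKl].
  - by move=> z _; rewrite lee_fin mulr_ge0// K0.
  - by rewrite lee_fin normal_pdf_ge0.
etransitivity; first apply: (fubini_tonelli (m1 := leb) (m2 := leb)
    (fun p : R * R => (\1_A (r * p.2) * K p.2 p.1 * normal_pdf 0 1 p.1)%:E)).
- apply/measurable_EFinP; apply: measurable_funM; last first.
    exact: measurableT_comp (measurable_normal_pdf 0 1) measurable_fst.
  apply: measurable_funM; first exact: measurableT_comp mA1 measurable_snd.
  exact: mK.
- by move=> p; rewrite lee_fin !mulr_ge0 ?normal_pdf_ge0.
rewrite normal_probE; last exact: mscal.
apply: eq_integral => z _ /=.
transitivity (\int[leb]_x ((\1_A (r * z) * normal_pdf 0 1 z)%:E * (K x z)%:E))%E.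
  apply: eq_integral => x _; rewrite -EFinM; congr EFin.
  rewrite -[LHS]mulrA -[RHS]mulrA; congr (_ * _).
  by rewrite /K -mulrA [_ * normal_pdf 0 1 x]mulrC normal_pdf_rotation// mulrCA.
rewrite ge0_integralZl//.
- by rewrite K1 mule1.
- apply/measurable_EFinP; exact: mKl.
- by move=> x _; rewrite lee_fin K0.
- by rewrite lee_fin mulr_ge0 ?normal_pdf_ge0.
Qed.

(** * Linear combinations of independent Gaussian variables *)

Lemma measurable_preimage_affine (a b : R) (A : set R) :
  measurable A -> measurable [set z | A (a * z + b)].
Proof.
by move=> mA; rewrite -[X in measurable X]setTI; exact: measurable_affine.
Qed.

(* Gaussian laws are encoded as images of N(0, 1) under z |-> s * z + m, so that
   s = 0 is the Dirac mass at m, whereas [normal_prob m 0] is a junk value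
   (a uniform law). *)
Lemma gauss_sum_step {d} {T : measurableType d} {P : probability T R}
    {E : set T} {Z X : T -> R} {sg mu s m c : R} (a : R) :
  0 <= c -> measurable E -> measurable_fun setT Z -> measurable_fun setT X ->
  (forall A B, measurable A -> measurable B ->
    P ((Z @^-1` A `&` X @^-1` B) `&` E) =
    (N01 [set z | A (sg * z + mu)%R] * N01 [set z | B (s * z + m)%R] * c%:E)%E) ->
  forall A, measurable A ->
  P ((fun om => a * X om + Z om) @^-1` A `&` E) =
  (N01 [set z | A (Num.sqrt (sg ^+ 2 + (a * s) ^+ 2) * z + (a * m + mu))%R] * c%:E)%E.
Proof.
move=> c0 mE mZ mX H A mA.
pose f om := (Z om, X om).
have mf : measurable_fun setT f by exact: measurable_fun_pair.
pose g (p : measurableTypeR R * measurableTypeR R) : R * R :=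
  (sg * p.1 + mu, s * p.2 + m).
have mg : measurable_fun setT g.
  by apply: measurable_fun_pair; apply: measurableT_comp (measurable_affine _ _) _.
(* Two measures on the plane: the affine image of N(0, 1) x N(0, 1) scaled to mass [c], and the law
   of [(Z, X)] on the event [E]. The hypothesis [H] equates them on rectangles, hence on the set
   [Y], which is not a rectangle. *)
pose m1 : {measure set (R * R) -> \bar R} :=
  mscale (NngNum c0) (pushforward (N01 \x N01)%E g).
pose m2 : {measure set (R * R) -> \bar R} := pushforward (mrestr P mE) f.
have m1T : (m1 mg setT < +oo)%E.
  rewrite /= /mscale /= /pushforward preimage_setT -setXTT product_measure1E//.
  rewrite -[X in (_ * X)%E]/(N01 setT * N01 setT)%E.
  rewrite [N01 setT]probability_setT mule1 mule1 ltry//.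
have m12 A1 A2 : measurable A1 -> measurable A2 ->
    m1 mg (A1 `*` A2) = m2 mf (A1 `*` A2).
  move=> mA1 mA2.
  rewrite /= /mscale /mrestr /= /pushforward.
  have -> : g @^-1` (A1 `*` A2) =
     [set z | A1 (sg * z + mu)] `*` [set z | A2 (s * z + m)] by [].
  rewrite product_measure1E//; [|exact: measurable_preimage_affine..].
  have -> : f @^-1` (A1 `*` A2) = Z @^-1` A1 `&` X @^-1` A2 by [].
  by rewrite H// muleC.
pose Y : set (R * R) := [set p | A (a * p.2 + p.1)].
have mY : measurable Y.
  rewrite -[X in measurable X]setTI.
  apply: (@measurable_funD _ _ _ _ (fun p : R * R => a * p.2) (fun p : R * R => p.1)) => //.
  - by apply: measurable_funM => //; exact: measurable_snd.
  - exact: measurable_fst.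
have := measure_prod_unique m1T m12 _ mY.
rewrite /= /mscale /mrestr /= /pushforward.
have -> : f @^-1` Y = (fun om => a * X om + Z om) @^-1` A by [].
move=> <-; rewrite muleC; congr (_ * _)%E.
(* The rotation lemma concerns centred combinations, so the mean is absorbed by translating [A]. *)
have := normal_prob_rotation sg (a * s) [set x | A (1 * x + (a * m + mu))]
  (measurable_preimage_affine _ _ _ mA).
rewrite /= => H2.
transitivity (N01 [set z | A (1 * (Num.sqrt (sg ^+ 2 + (a * s) ^+ 2) * z) + (a * m + mu))]).
  rewrite -H2; congr (product_measure1 _ _ _).
  by apply/seteqP; split => p; rewrite /Y /g /=; congr A; ring.
by congr normal_prob; apply/seteqP; split => z /=; rewrite mul1r.
Qed.

Lemma measurable_linear_comb {d} {T : measurableType d} {I : finType}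
    {K : {set I}} {X : I -> T -> R} (a : I -> R) :
  (forall i, i \in K -> measurable_fun setT (X i)) ->
  measurable_fun setT (fun om => \sum_(i in K) a i * X i om).
Proof.
move=> mX; under eq_fun do rewrite big_mkcond/=.
apply: measurable_sum => i; have [iK|_] := boolP (i \in K); last exact: measurable_cst.
by apply: measurable_funM => //; exact: mX.
Qed.

(* The events on the remaining variables carry independence through the induction
   on K. *)
Lemma indep_gauss_partial_sum {d} {T : measurableType d} {P : probability T R}
    {I : finType} {J : {set I}} {X : I -> T -> R} (a s m : I -> R) :
  (forall i, i \in J -> measurable_fun setT (X i)) ->
  indep_family P J X ->
  (forall i, i \in J -> forall B : set R, measurable B ->
    P (X i @^-1` B) = N01 [set z | B (s i * z + m i)]) ->
  forall K : {set I}, K \subset J ->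
  forall (A : set R) (B : I -> set R), measurable A -> (forall i, measurable (B i)) ->
  P ((fun om => \sum_(i in K) a i * X i om) @^-1` A `&`
     \bigcap_(i in [set i | i \in (J :\: K)%SET]) (X i @^-1` B i)) =
  (N01 [set z | A (Num.sqrt (\sum_(i in K) (a i * s i) ^+ 2) * z +
                   \sum_(i in K) a i * m i)%R] *
   \prod_(i in (J :\: K)%SET) P (X i @^-1` B i))%E.
Proof.
move=> mX indX lawX K; move: {2}#|K| (erefl #|K|) => n.
elim: n K => [|n IH] K.
  move=> /eqP; rewrite cards_eq0 => /eqP -> _ A B mA mB.
  rewrite finset.setD0 !big_set0 sqrtr0.
  have -> : (fun om => \sum_(i in finset.set0) a i * X i om) = cst 0.
    by apply/funext => om; rewrite big_set0.
  (* An empty sum is the Dirac mass at 0, so both sides depend only on whether [A] contains 0. *)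
  have [A0|nA0] := pselect (A 0).
    have -> : [set z : R | A (0 * z + 0)] = setT.
      by apply/seteqP; split => // z _ /=; rewrite mul0r addr0.
    have -> : cst 0 @^-1` A = [set: T] by apply/seteqP; split.
    by rewrite setTI [N01 _]probability_setT mul1e indX.
  have -> : [set z : R | A (0 * z + 0)] = set0.
    by apply/seteqP; split => // z /=; rewrite mul0r addr0.
  have -> : cst 0 @^-1` A = set0 :> set T by apply/seteqP; split.
  by rewrite set0I [N01 _]measure0 mul0e measure0.
move=> cK KJ A B mA mB.
have [k kK] : exists k, k \in K by apply/set0Pn; rewrite -cards_eq0 cK.
pose K' := (K :\ k)%SET.
have cK' : #|K'| = n by have := cardsD1 k K; rewrite kK cK add1n => -[].
have kJ : k \in J by exact: (fintype.subsetP KJ).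
have K'J : K' \subset J by apply: fintype.subset_trans KJ; exact: subD1set.
have kJK' : k \in (J :\: K')%SET by rewrite !inE kJ eqxx.
have JK : (J :\: K)%SET = ((J :\: K') :\ k)%SET.
  apply/setP => i; rewrite !inE; have [->|] := eqVneq i k; first by rewrite kK.
  by case: (i \in K).
have mXB i : i \in J -> measurable (X i @^-1` B i).
  by move=> iJ; rewrite -[Y in measurable Y]setTI; exact: mX.
set E := \bigcap_(i in _) _.
have mE : measurable E.
  apply: fin_bigcap_measurable => // i; rewrite /= !inE => /andP[_ iJ].
  exact: mXB.
set p := (\prod_(i in _) _)%E.
have p0 : (0 <= p)%E by exact: prode_ge0.
have pfin : p \is a fin_num.
  apply: (big_ind (fun x : \bar R => x \is a fin_num)) => // [x y|i]; first exact: fin_numM.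
  by rewrite !inE => /andP[_ iJ]; apply: fin_num_measure; exact: mXB.
pose Z om := \sum_(i in K') a i * X i om.
have mZ : measurable_fun setT Z.
  by apply: measurable_linear_comb => i iK; apply: mX; exact: (fintype.subsetP K'J).
have step A' B' : measurable A' -> measurable B' ->
    P ((Z @^-1` A' `&` X k @^-1` B') `&` E) =
    (N01 [set z | A' (Num.sqrt (\sum_(i in K') (a i * s i) ^+ 2) * z + \sum_(i in K') a i * m i)%R] *
     N01 [set z | B' (s k * z + m k)%R] * (fine p)%:E)%E.
  (* With [B'] inserted at index [k], the event on [X k] is one of the remaining events for [K'], so
     the induction hypothesis yields the product form required by [gauss_sum_step]. *)
  move=> mA' mB'; pose B2 i := if i == k then B' else B i.
  have mB2 i : measurable (B2 i) by rewrite /B2; case: ifP.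
  have := IH K' cK' K'J A' B2 mA' mB2.
  have B2k : B2 k = B' by rewrite /B2 eqxx.
  rewrite (big_setD1 _ kJK')/= -JK B2k lawX//.
  have -> : (\prod_(i in (J :\: K)%SET) P (X i @^-1` B2 i) = p)%E.
    apply: eq_bigr => i; rewrite !inE /B2.
    by have [->|//] := eqVneq i k; rewrite kK.
  rewrite fineK// muleA.
  move=> <-; congr (P _); rewrite -setIA; congr (_ `&` _).
  apply/seteqP; split => om /=.
    move=> [XB EB] i /=; rewrite /B2; case: eqVneq => [->//|ik] iJ.
    by apply: EB; rewrite /= JK in_setD1 ik.
  move=> H; split; first by have := H k kJK'; rewrite /B2 eqxx.
  move=> i /= iJ; have /H : i \in (J :\: K')%SET by move: iJ; rewrite JK !inE => /andP[].
  by rewrite /B2; case: eqVneq => // ik; move: iJ; rewrite !inE ik kK.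
have := gauss_sum_step (a k) (fine_ge0 p0) mE mZ (mX k kJ) step A mA.
rewrite fineK// sqr_sqrtr ?sumr_ge0//; last by move=> i _; exact: sqr_ge0.
rewrite [\sum_(i in K) (a i * s i) ^+ 2](big_setD1 k)//= [\sum_(i in K) a i * m i](big_setD1 k)//=.
rewrite [X in Num.sqrt X]addrC => <-.
congr (P (_ `&` _)); apply/seteqP; split => om /=; by rewrite (big_setD1 k)/=.
Qed.

Lemma indep_gauss_sum {d} {T : measurableType d} {P : probability T R}
    {I : finType} {J : {set I}} {X : I -> T -> R} (a s m : I -> R) :
  (forall i, i \in J -> measurable_fun setT (X i)) ->
  indep_family P J X ->
  (forall i, i \in J -> forall B : set R, measurable B ->
    P (X i @^-1` B) = N01 [set z | B (s i * z + m i)]) ->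
  forall A : set R, measurable A ->
  P ((fun om => \sum_(i in J) a i * X i om) @^-1` A) =
  N01 [set z | A (Num.sqrt (\sum_(i in J) (a i * s i) ^+ 2) * z +
                   \sum_(i in J) a i * m i)].
Proof.
move=> mX indX lawX A mA.
have := indep_gauss_partial_sum a s m mX indX lawX J (fintype.subxx _) A
  (fun=> setT) mA (fun=> measurableT).
rewrite finset.setDv big_set0 mule1 => <-; congr (P _).
by apply/seteqP; split => om /= => [HA|[]//]; split => // i /=; rewrite inE.
Qed.

(** [Qfun] is the mass of an open half-line, while the error event, which includes ties, is closed.
    The normal law has no atoms, so the endpoint can be added. *)
Lemma Qfun_ge (b c : R) : b <= c -> (N01 `[c, +oo[ <= Qfun b)%E.
Proof.
move=> bc; have -> : Qfun b = N01 `[b, +oo[.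
  rewrite /Qfun /normal_prob integral_itv_obnd_cbnd//.
  by apply/measurable_EFinP/measurable_funTS; exact: measurable_normal_pdf.
apply: le_measure; rewrite ?inE//; try exact: measurable_itv.
by move=> x /=; rewrite !in_itv/= !andbT; exact: le_trans.
Qed.

End gaussian.

(** * Cauchy-Schwarz estimates between centroids *)

Section distances.
Context {R : realType} {L D : nat}.
Variables (mu : 'I_L -> 'I_D -> R) (C : 'I_D -> R) (Dsel : {set 'I_D}).
Hypothesis C0 : forall dd, 0 < C dd.

(** The sum of (A v_i - X u_i)^2 / C_i is nonnegative and expands to A (A B - X^2); then A > 0 is
    cancelled. *)
Lemma weighted_cauchy_schwarz (u v : 'I_D -> R) :
  0 < \sum_(i in Dsel) u i ^+ 2 / C i ->
  \sum_(i in Dsel) u i * v i / C i <=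
  Num.sqrt (\sum_(i in Dsel) u i ^+ 2 / C i) *
  Num.sqrt (\sum_(i in Dsel) v i ^+ 2 / C i).
Proof.
set A := (X in 0 < X); set X := \sum_(i in Dsel) u i * _ / _.
set B := \sum_(i in Dsel) v i ^+ 2 / C i => A0.
rewrite -sqrtrM; last exact: ltW.
apply: (le_trans (ler_norm _)).
rewrite -sqrtr_sqr ler_sqrt; last first.
  apply: mulr_ge0; first exact: ltW.
  by apply: sumr_ge0 => i _; rewrite divr_ge0 ?sqr_ge0// ltW.
rewrite -(ler_pM2l A0) -subr_ge0.
have -> : A * (A * B) - A * X ^+ 2 =
    \sum_(i in Dsel) (A * v i - X * u i) ^+ 2 / C i.
  transitivity (A ^+ 2 * B - 2 * A * X * X + X ^+ 2 * A); first by ring.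
  have -> : A ^+ 2 * B = \sum_(i in Dsel) A ^+ 2 * (v i ^+ 2 / C i) by rewrite mulr_sumr.
  have -> : 2 * A * X * X = \sum_(i in Dsel) 2 * A * X * (u i * v i / C i).
    by rewrite -mulr_sumr.
  have -> : X ^+ 2 * A = \sum_(i in Dsel) X ^+ 2 * (u i ^+ 2 / C i) by rewrite mulr_sumr.
  rewrite -sumrB -big_split/=.
  by apply: eq_bigr => i _; ring.
by apply: sumr_ge0 => i _; rewrite divr_ge0 ?sqr_ge0// ltW.
Qed.

Lemma Gpair_ge0 l l' : 0 <= Gpair mu C Dsel l l'.
Proof. by apply: sumr_ge0 => i _; rewrite divr_ge0 ?sqr_ge0// ltW. Qed.

Lemma Gpair_gt0 l l' :
  (exists2 dd, dd \in Dsel & mu l dd != mu l' dd) -> 0 < Gpair mu C Dsel l l'.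
Proof.
move=> [dd ddD nmu]; rewrite /Gpair (bigD1 dd)//= ltr_pwDl//.
  by rewrite divr_gt0// exprn_even_gt0//= subr_eq0.
by apply: sumr_ge0 => i _; rewrite divr_ge0 ?sqr_ge0// ltW.
Qed.

Lemma Gmin_le l l' : l != l' -> Gmin mu C Dsel <= Gpair mu C Dsel l l'.
Proof.
move=> ll'; apply: ge_inf; last by exists l, l'.
by exists 0 => _ [l1 [l2 [_ ->]]]; exact: Gpair_ge0.
Qed.

Lemma le_delta_max l :
  Num.sqrt (\sum_(dd in Dsel) mu l dd ^+ 2 / C dd) <= delta_max mu C Dsel.
Proof.
apply: ub_le_sup; last by exists l.
(* All the norms are nonnegative, so their sum bounds each of them. *)
exists (\sum_l' Num.sqrt (\sum_(dd in Dsel) mu l' dd ^+ 2 / C dd)) => _ [l' _ <-].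
by rewrite [leRHS](bigD1 l')//= lerDl sumr_ge0.
Qed.

(** Cauchy-Schwarz is applied separately to the [mu l1] and [- mu l0] parts; each contributes one
    [delta_max], whence the factor 2. *)
Lemma mean_shift_le l l0 l1 : 0 < Gpair mu C Dsel l l0 ->
  \sum_(dd in Dsel) (mu l dd - mu l0 dd) * (mu l1 dd - mu l0 dd) / C dd <=
  2 * delta_max mu C Dsel * Num.sqrt (Gpair mu C Dsel l l0).
Proof.
move=> G0.
have cs1 := weighted_cauchy_schwarz _ (mu l1) G0.
have cs2 := weighted_cauchy_schwarz _ (fun dd => - mu l0 dd) G0.
have -> : \sum_(dd in Dsel) (mu l dd - mu l0 dd) * (mu l1 dd - mu l0 dd) / C dd =
   \sum_(dd in Dsel) (mu l dd - mu l0 dd) * mu l1 dd / C dd +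
   \sum_(dd in Dsel) (mu l dd - mu l0 dd) * (- mu l0 dd) / C dd.
  by rewrite -big_split/=; apply: eq_bigr => dd _; ring.
rewrite (_ : 2 * _ * _ = Num.sqrt (Gpair mu C Dsel l l0) * delta_max mu C Dsel +
  Num.sqrt (Gpair mu C Dsel l l0) * delta_max mu C Dsel); last by ring.
apply: lerD; [apply: (le_trans cs1)|apply: (le_trans cs2)];
  apply: ler_wpM2l; rewrite ?sqrtr_ge0//; first exact: le_delta_max.
under eq_bigr do rewrite sqrrN.
exact: le_delta_max.
Qed.

(** * Pairwise comparison of the true class with a wrong one *)

Context {S : finType}.
Variable w : S -> R.
Hypothesis w0 : forall m, 0 <= w m.
Hypothesis w1 : \sum_m w m = 1.

Definition half_gap l l0 := \sum_(dd in Dsel) (mu l dd ^+ 2 - mu l0 dd ^+ 2) / 2 / C dd.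

(** The squares of the fused feature cancel in the difference of the two distances, which is twice
    the linear statistic minus [half_gap]. *)
Lemma maha_le (T : Type) (f : S -> 'I_D -> T -> R) om l l0 :
  (maha w mu C Dsel f om l <= maha w mu C Dsel f om l0) =
  (half_gap l l0 <= \sum_m \sum_(dd in Dsel)
     w m * (mu l dd - mu l0 dd) / C dd * f m dd om).
Proof.
rewrite -subr_ge0 -[in RHS]subr_ge0 -(pmulr_rge0 (_ - half_gap l l0) (ltr0Sn _ 1)).
congr (0 <= _).
rewrite exchange_big/= /maha /half_gap -!sumrB mulr_sumr; apply: eq_bigr => dd _.
have -> : \sum_m w m * (mu l dd - mu l0 dd) / C dd * f m dd om =
    (mu l dd - mu l0 dd) / C dd * \sum_m w m * f m dd om.
  by rewrite mulr_sumr; apply: eq_bigr => m _; ring.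
by field; rewrite gt_eqF.
Qed.

(** Because the weights sum to 1, the margin is an average over sensors. A relevant sensor
    contributes exactly G / 2, and an irrelevant one at least G / 2 minus the shift bounded by
    [mean_shift_le]. Finally G is at least sqrt [Gmin] times sqrt G. *)
Lemma margin_le (I : S -> bool) (lm : S -> 'I_L) l l0 :
  l != l0 -> 0 < Gpair mu C Dsel l l0 ->
  (Num.sqrt (Gmin mu C Dsel) / 2 -
     2 * (1 - \sum_m (I m)%:R * w m) * delta_max mu C Dsel) *
    Num.sqrt (Gpair mu C Dsel l l0) <=
  half_gap l l0 - \sum_m \sum_(dd in Dsel)
     w m * (mu l dd - mu l0 dd) / C dd * mu (if I m then l0 else lm m) dd.
Proof.
move=> ll0 G0; set G := Gpair mu C Dsel l l0 in G0 *.
set de := delta_max mu C Dsel; set g := Num.sqrt G.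
have gG : g * g = G by rewrite -expr2 sqr_sqrtr// ltW.
have Gm : Num.sqrt (Gmin mu C Dsel) * g <= G.
  by rewrite -gG ler_wpM2r ?sqrtr_ge0// ler_wsqrtr// Gmin_le.
apply: (@le_trans _ _ (\sum_m w m * (G / 2 - (1 - (I m)%:R) * (2 * de * g)))).
  have -> : \sum_m w m * (G / 2 - (1 - (I m)%:R) * (2 * de * g)) =
      G / 2 * (\sum_m w m) - 2 * de * g * (\sum_m w m - \sum_m (I m)%:R * w m).
    by rewrite -sumrB !mulr_sumr -sumrB; apply: eq_bigr => m _; ring.
  by rewrite w1; lra.
have -> : half_gap l l0 = \sum_m w m * half_gap l l0.
  by rewrite -mulr_suml w1 mul1r.
rewrite -sumrB; apply: ler_sum => m _.
have -> : w m * half_gap l l0 - \sum_(dd in Dsel) w m * (mu l dd - mu l0 dd) / C dd *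
      mu (if I m then l0 else lm m) dd =
    w m * (G / 2 - \sum_(dd in Dsel) (mu l dd - mu l0 dd) *
      (mu (if I m then l0 else lm m) dd - mu l0 dd) / C dd).
  rewrite /half_gap /G /Gpair [_ / 2]mulr_suml -sumrB !mulr_sumr -sumrB.
  by apply: eq_bigr => dd _; field; rewrite gt_eqF.
apply: ler_wpM2l => //; rewrite lerD2l lerN2.
case: (I m); last by rewrite subr0 mul1r; exact: mean_shift_le.
by rewrite subrr mul0r big1// => dd _; rewrite subrr mulr0 mul0r.
Qed.

(** Ties belong to [B], so it contains the event of choosing [l] under any tie-breaking rule. *)
Lemma pairwise_error_le d (T : measurableType d) (P : probability T R)
    (f : S -> 'I_D -> T -> R) (I : S -> bool) (lm : S -> 'I_L) l l0 :
  l != l0 -> 0 < Gpair mu C Dsel l l0 ->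
  gauss_sensor_model P mu C Dsel (fun m => if I m then l0 else lm m) f ->
  let rho := \sum_(m : S) (I m)%:R * w m in
  let eta := \sum_(m : S) w m ^+ 2 in
  let B := [set om | maha w mu C Dsel f om l <= maha w mu C Dsel f om l0] in
  measurable B /\
  (P B <= Qfun ((Num.sqrt eta)^-1 *
       (Num.sqrt (Gmin mu C Dsel) / 2 - 2 * (1 - rho) * delta_max mu C Dsel)))%E.
Proof.
move=> ll0 G0 [mf indf lawf] rho eta B.
(* If [eta] vanished, every weight would be 0, against their sum being 1. *)
have eta0 : 0 < eta.
  rewrite lt0r sumr_ge0 ?andbT; last by move=> m _; exact: sqr_ge0.
  apply/eqP => /eqP; rewrite psumr_eq0 => [/allP eta0|m _]; last exact: sqr_ge0.
  have := w1; rewrite big1 => [/eqP|m _]; first by rewrite eq_sym oner_eq0.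
  by have /= := eta0 m (mem_index_enum m); rewrite sqrf_eq0 => /eqP.
(* Sensors and selected coordinates form a single index set, so the statistic is one linear
   combination of independent normal variables. *)
pose J : {set S * 'I_D} := [set p : S * 'I_D | p.2 \in Dsel]%SET.
have sumJ (F : S -> 'I_D -> R) :
    \sum_(p in J) F p.1 p.2 = \sum_m \sum_(dd in Dsel) F m dd.
  by rewrite pair_big/=; apply: eq_bigl => p; rewrite inE.
pose a (p : S * 'I_D) := w p.1 * (mu l p.2 - mu l0 p.2) / C p.2.
pose s (p : S * 'I_D) := Num.sqrt (C p.2).
pose mn (p : S * 'I_D) := mu (if I p.1 then l0 else lm p.1) p.2.
pose X (p : S * 'I_D) := f p.1 p.2.
have mX p : p \in J -> measurable_fun setT (X p) by rewrite inE; exact: mf.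
have lawX p : p \in J -> forall A : set R, measurable A ->
    P (X p @^-1` A) = normal_prob 0 1 [set z | A (s p * z + mn p)].
  rewrite inE => pD A mA; rewrite lawf// -normal_prob_affine//.
    by rewrite ger0_norm ?sqrtr_ge0.
  by rewrite sqrtr_eq0 -ltNge.
have BE : B = (fun om => \sum_(p in J) a p * X p om) @^-1` `[half_gap l l0, +oo[.
  apply/seteqP; split => om; rewrite /B /= maha_le in_itv/= andbT;
  by rewrite (sumJ (fun m dd => w m * (mu l dd - mu l0 dd) / C dd * f m dd om)).
have mI : measurable (`[half_gap l l0, +oo[ : set R) by exact: measurable_itv.
have mB : measurable B.
  rewrite BE -[Y in measurable Y]setTI.
  exact: (measurable_linear_comb a mX).
split => //; rewrite BE (indep_gauss_sum a s mn mX indf lawX)//.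
have -> : \sum_(i in J) (a i * s i) ^+ 2 = eta * Gpair mu C Dsel l l0.
  rewrite (sumJ (fun m dd => (w m * (mu l dd - mu l0 dd) / C dd * Num.sqrt (C dd)) ^+ 2)).
  rewrite /eta mulr_suml; apply: eq_bigr => m _.
  rewrite /Gpair mulr_sumr; apply: eq_bigr => dd _.
  rewrite exprMn sqr_sqrtr; last exact: ltW.
  by field; rewrite gt_eqF.
rewrite (sumJ (fun m dd => w m * (mu l dd - mu l0 dd) / C dd * mu (if I m then l0 else lm m) dd)).
have := margin_le I lm l l0 ll0 G0.
set M := \sum_m \sum_(dd in Dsel) _; rewrite sqrtrM; last exact: ltW.
rewrite -/rho.
set b := _ / 2 - _; set g := Num.sqrt (Gpair _ _ _ _ _) => H.
have g0 : 0 < g by rewrite sqrtr_gt0.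
have e0 : 0 < Num.sqrt eta by rewrite sqrtr_gt0.
(* Standardising divides the threshold by sqrt(eta) g; the factor [g] in [margin_le] then
   cancels. *)
rewrite (_ : [set z | _] = `[(half_gap l l0 - M) / (Num.sqrt eta * g), +oo[%classic).
  apply: Qfun_ge; rewrite ler_pdivlMr ?mulr_gt0//.
  by rewrite mulrA -[_ * b * _]mulrAC mulVf ?gt_eqF// mul1r.
apply/seteqP; split => z /=; rewrite !in_itv/= !andbT ler_pdivrMr ?mulr_gt0//;
by rewrite lerBlDr (mulrC z).
Qed.

End distances.

(** * Union bound over the wrong classes *)

Section accuracy.
Context {R : realType} {L D : nat} {mu : 'I_L -> 'I_D -> R} {C : 'I_D -> R}
  {Dsel : {set 'I_D}} {S : finType} {w : S -> R}.

(** The events [lhat = l] partition the space, so their probabilities add up to 1, of which each of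
    the L - 1 wrong classes takes at most [q]. *)
Lemma acc_bound_le d (T : measurableType d) (P : probability T R)
    (f : S -> 'I_D -> T -> R) (I : S -> bool) (lm : S -> 'I_L) l0 lhat :
  (forall dd, 0 < C dd) ->
  (forall l l' : 'I_L, l != l' -> exists2 dd, dd \in Dsel & mu l dd != mu l' dd) ->
  (forall m, 0 <= w m) -> \sum_(m : S) w m = 1 ->
  gauss_sensor_model P mu C Dsel (fun m => if I m then l0 else lm m) f ->
  is_mindist_classifier w mu C Dsel f lhat ->
  (forall l, measurable [set om | lhat om = l]) ->
  (acc_bound w I mu C Dsel <= P [set om | lhat om = l0])%E.
Proof.
move=> C0 sep w0 w1 model mind mlhat; rewrite /acc_bound.
set q := Qfun _.
have q_ge l : l != l0 -> (P [set om | lhat om = l] <= q)%E.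
  move=> ll0.
  have G0 : 0 < Gpair mu C Dsel l l0 by apply: Gpair_gt0 => //; exact: sep.
  have [mB PB] := pairwise_error_le _ _ _ C0 w w0 w1 _ _ _ _ _ _ _ _ ll0 G0 model.
  apply: le_trans PB; apply: le_measure; rewrite ?inE//.
  by move=> om /= <-; exact: mind.
have total : (\sum_(l < L) P [set om | lhat om = l] = 1)%E.
  rewrite -(measure_bigsetU_ord _ xpredT)//=; last first.
    by move=> l l' _ _ [om [/= <- <-]].
  rewrite -(probability_setT P); congr (P _); apply/seteqP; split => // om _.
  by rewrite (bigD1 (lhat om))//=; left.
(* Finiteness is what permits moving the term across the subtraction in the extended reals. *)
have qfin : q \is a fin_num by apply: fin_num_measure; exact: measurable_itv.
rewrite leeBlDr ?fin_numM// -total (bigD1 l0)//= leeD2l//.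
apply: (@le_trans _ _ (\sum_(l < L | l \in predC1 l0) q)%E); first exact: lee_sum.
by rewrite sumr_const cardC1 card_ord mule_natl.
Qed.

Lemma acc_bound_fin_num I : acc_bound w I mu C Dsel \is a fin_num.
Proof.
rewrite /acc_bound fin_numB/= fin_numM//.
by apply: fin_num_measure; exact: measurable_itv.
Qed.

End accuracy.

Theorem theorem1 (R : realType) (L D : nat) (mu : 'I_L -> 'I_D -> R)
  (C : 'I_D -> R) (Dsel : {set 'I_D}) (S : finType) (w : S -> R) :
  (2 <= L)%N -> (1 <= D)%N -> (forall dd, 0 < C dd) -> (0 < #|Dsel|)%N ->
  (forall l l' : 'I_L, l != l' -> exists2 dd, dd \in Dsel & mu l dd != mu l' dd) ->
  (0 < #|S|)%N -> (forall m, 0 <= w m) -> \sum_(m : S) w m = 1 ->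
  (* per-configuration bound *)
  (forall (I : S -> bool) (l0 : 'I_L) (lm : S -> 'I_L),
    (forall m, ~~ I m -> lm m != l0) ->
    forall (dsp : measure_display) (T : measurableType dsp)
      (P : probability T R) (f : S -> 'I_D -> T -> R) (lhat : T -> 'I_L),
    gauss_sensor_model P mu C Dsel (fun m => if I m then l0 else lm m) f ->
    is_mindist_classifier w mu C Dsel f lhat ->
    (forall l, measurable [set om | lhat om = l]) ->
    (acc_bound w I mu C Dsel <= P [set om | lhat om = l0])%E)
  /\
  (* averaged over uniform l0 and any distribution q l0 of the classes of
     the irrelevant sensors (supported on assignments with g m <> l0) *)
  (forall (I : S -> bool) (q : 'I_L -> {ffun S -> 'I_L} -> R),
    (forall l0 g, 0 <= q l0 g) ->
    (forall l0, \sum_(g : {ffun S -> 'I_L}) q l0 g = 1) ->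
    (forall l0 (g : {ffun S -> 'I_L}), (exists2 m, ~~ I m & g m = l0) -> q l0 g = 0) ->
    forall (dsp : measure_display)
      (T : 'I_L -> {ffun S -> 'I_L} -> measurableType dsp)
      (P : forall l0 g, probability (T l0 g) R)
      (f : forall l0 g, S -> 'I_D -> T l0 g -> R)
      (lhat : forall l0 g, T l0 g -> 'I_L),
    (forall l0 (g : {ffun S -> 'I_L}), (forall m, ~~ I m -> g m != l0) ->
      [/\ gauss_sensor_model (P l0 g) mu C Dsel
            (fun m => if I m then l0 else g m) (f l0 g),
          is_mindist_classifier w mu C Dsel (f l0 g) (lhat l0 g) &
          forall l, measurable [set om | lhat l0 g om = l]]) ->
    (acc_bound w I mu C Dsel <=
      \sum_(l0 : 'I_L) ((L%:R)^-1)%:E *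
        \sum_(g : {ffun S -> 'I_L}) (q l0 g)%:E * P l0 g [set om | lhat l0 g om = l0])%E).

Proof.
move=> L2 _ C0 _ sep _ w0 w1; split.
  move=> I l0 lm _ dsp T P f lhat model mind mlhat.
  exact: (acc_bound_le _ _ _ _ _ lm _ _ C0 sep w0 w1 model mind mlhat).
move=> I q q0 q1 qsupp dsp T P f lhat H.
have [b bE] : exists b, acc_bound w I mu C Dsel = b%:E.
  by exists (fine (acc_bound w I mu C Dsel)); rewrite fineK// acc_bound_fin_num.
have inner l0 : (b%:E <= \sum_g (q l0 g)%:E * P l0 g [set om | lhat l0 g om = l0])%E.
  have -> : b%:E = (\sum_g (q l0 g)%:E * b%:E)%E.
    under eq_bigr do rewrite -EFinM.
    by rewrite sumEFin -mulr_suml q1 mul1r.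
  apply: lee_sum => g _.
  (* An assignment giving class [l0] to an irrelevant sensor has weight 0, so both terms vanish; any
     other satisfies the hypotheses of the fixed-configuration bound. *)
  have [gl0|] := pselect (exists2 m, ~~ I m & g m = l0).
    by rewrite (qsupp _ _ gl0) !mul0e.
  move=> ngl0; rewrite lee_wpmul2l ?lee_fin// -bE.
  have [m Im|model mind mlhat] := H l0 g.
    by apply/eqP => gm; apply: ngl0; exists m.
  exact: (acc_bound_le _ _ _ _ _ g _ _ C0 sep w0 w1 model mind mlhat).
have L0 : L%:R != 0 :> R by rewrite pnatr_eq0 -lt0n (ltn_trans _ L2).
have -> : acc_bound w I mu C Dsel = (\sum_(l0 : 'I_L) ((L%:R)^-1)%:E * b%:E)%E.
  rewrite bE; under eq_bigr do rewrite -EFinM.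
  by rewrite sumEFin sumr_const card_ord -mulrnAl -mulr_natr mulVf// mul1r.
by apply: lee_sum => l0 _; rewrite lee_wpmul2l// lee_fin invr_ge0.
Qed.
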